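(* Let $\ell\geq 2$ be an integer. Then $$\mathcal{C}_{4\ell}^{\operatorname{hom}}:=\operatorname{cl}\left(\left\{\left(\frac{\operatorname{hom}(C_8;G)}{\operatorname{hom}(C_4;G)^2}, \frac{\operatorname{hom}(C_{12};G)}{\operatorname{hom}(C_4;G)^3}, \ldots, \frac{\operatorname{hom}(C_{4\ell};G)}{\operatorname{hom}(C_4;G)^\ell}\right) \;\middle|\; G \text{ a graph with } \operatorname{hom}(C_4;G)\neq 0\right\}\right)$$ is equal to the power-sum profile $\Pi_\ell$.
   Context: Graphs are finite simple graphs. For graphs $H,G$, $\operatorname{hom}(H;G)$ is the number of maps $V(H)\to V(G)$ sending every edge of $H$ to an edge of $G$. $C_i$ denotes the cycle with $i$ vertices. $\operatorname{cl}$ denotes topological closure in $\mathbb{R}^{\ell-1}$. For $\mathbf{x}\in\mathbb{R}^n$ and $i\in\mathbb{N}$, $p_i(\mathbf{x})=\sum_{j=1}^n x_j^i$. Let $\Pi_{n,\ell}=\{(p_2(\mathbf{x}),\ldots,p_\ell(\mathbf{x})) : \mathbf{x}\in\mathbb{R}^n_{\geq 0},\ p_1(\mathbf{x})=1\}$ and the power-sum profile $\Pi_\ell=\operatorname{cl}\left(\bigcup_{n\in\mathbb{N}}\Pi_{n,\ell}\right)\subseteq\mathbb{R}^{\ell-1}$. *)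

(* Defs.v *)
From HB Require Import structures.
From mathcomp Require Import all_boot all_order all_algebra.
From mathcomp Require Import all_classical all_reals all_analysis.

Set Implicit Arguments.
Unset Strict Implicit.
Unset Printing Implicit Defensive.

Import Order.TTheory GRing.Theory Num.Theory.
Import numFieldNormedType.Exports.

Local Open Scope classical_set_scope.
Local Open Scope ring_scope.

Record sgraph := SGraph {
  vertex :> finType;
  adj : rel vertex;
  adj_sym : symmetric adj;
  adj_irr : irreflexive adj }.

Definition is_hom (H G : sgraph) (f : {ffun H -> G}) : bool :=
  [forall x : H, forall y : H, adj x y ==> adj (f x) (f y)].

Definition hom_count (H G : sgraph) : nat := #|[pred f : {ffun H -> G} | is_hom f]|.

(* [ordS x] is the successor of [x] modulo [n]. The conjunct [x != y] only
   matters for [n = 1], where it removes the loop; for [3 <= n] this is the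
   n-cycle. *)
Definition cycle_adj (n : nat) : rel 'I_n :=
  fun x y => (x != y) && ((y == ordS x) || (x == ordS y)).

Lemma cycle_adj_sym n : symmetric (@cycle_adj n).
Proof. by move=> x y; rewrite /cycle_adj eq_sym orbC. Qed.

Lemma cycle_adj_irr n : irreflexive (@cycle_adj n).
Proof. by move=> x; rewrite /cycle_adj eqxx. Qed.

Definition cycle_graph (n : nat) : sgraph :=
  SGraph (@cycle_adj_sym n) (@cycle_adj_irr n).

Definition power_sum (R : realType) (n i : nat) (x : 'rV[R]_n) : R :=
  \sum_(j < n) x 0 j ^+ i.

(* In the profiles below, coordinate [k : 'I_l.-1] carries the index [k.+2],
   which runs over 2, ..., l. *)
Definition power_sum_set (R : realType) (n l : nat) : set 'rV[R]_(l.-1) :=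
  [set v | exists x : 'rV[R]_n,
     [/\ forall j, 0 <= x 0 j,
         power_sum 1 x = 1 &
         v = \row_(k < l.-1) power_sum k.+2 x]].
Arguments power_sum_set R n l _ : clear implicits.

Definition power_sum_profile (R : realType) (l : nat) : set 'rV[R]_(l.-1) :=
  closure (\bigcup_(n in [set: nat]) power_sum_set R n l).
Arguments power_sum_profile R l _ : clear implicits.

Definition cycle_point (R : realType) (l : nat) (G : sgraph) : 'rV[R]_(l.-1) :=
  \row_(k < l.-1) ((hom_count (cycle_graph (4 * k.+2)) G)%:R
                   / (hom_count (cycle_graph 4) G)%:R ^+ k.+2).

Definition cycle_profile (R : realType) (l : nat) : set 'rV[R]_(l.-1) :=
  closure [set v | exists2 G : sgraph,
                     hom_count (cycle_graph 4) G <> 0%N & v = cycle_point R l G].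
Arguments cycle_profile R l _ : clear implicits.

(* Main.v *)
Require Import Defs.
From mathcomp Require Import all_boot all_order all_algebra.
From mathcomp Require Import all_classical all_reals all_analysis.
From mathcomp Require Import complex.

(** Counting closed walks gives hom(C_n; G) = tr A^n, where A is the adjacency
    matrix of G. As A is real symmetric, tr A^(4k) is the sum of the (r_i^4)^k
    over its eigenvalues r_i, so the cycle point of G is exactly the power-sum
    point of the nonnegative vector (r_i^4 / tr A^4)_i, whose entries add up
    to 1.

    Conversely, given x >= 0 with sum 1, take disjoint cliques with about
    M x_j^(1/4) vertices. A homomorphism from a cycle stays in one clique, and
    injective maps into a clique are homomorphisms, so that the number of
    homomorphisms from C_N lies between the sums of the falling factorials
    (m_j)_N and of the powers m_j^N of the clique sizes. Both are equivalent to
    M^N times the sum of the x_j^(N/4), and letting M tend to infinity gives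
    the power-sum point of x as a limit of cycle points. *)

Set Implicit Arguments.
Unset Strict Implicit.
Unset Printing Implicit Defensive.

Import Order.TTheory GRing.Theory Num.Theory.
Import numFieldNormedType.Exports.

Local Open Scope classical_set_scope.
Local Open Scope ring_scope.

(** * Closed walks and the spectrum of the adjacency matrix *)

Lemma ordS_val n (i : 'I_n) : ordS i = (if i.+1 == n then 0 else i.+1)%N :> nat.
Proof.
case: n i => [[]//|n] i /=; case: eqP => [->|/eqP ne]; first exact: modnn.
by rewrite modn_small // ltn_neqAle ne ltn_ord.
Qed.

(** Links the cyclic successor on indices to paths in sequences, which is the form that matrix
    powers count. The wrap-around index is the final step of [path e x (rcons p x)]. *)
Lemma cycle_mktuple (T : Type) (e : rel T) n (f : 'I_n -> T) :
  cycle e [tuple f i | i < n] = [forall i, e (f i) (f (ordS i))].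
Proof.
case: n f => [|n] f.
  by rewrite tuple0; apply/esym/forallP => -[].
set s := [tuple f i | i < n.+1]; have x0 := f ord0.
have nthE (i : 'I_n.+1) : nth x0 s i = f i by rewrite -tnth_nth tnth_mktuple.
have : size s = n.+1 by rewrite size_tuple.
case Ds: (val s) => [//|x p] /= [szp].
rewrite Ds in nthE.
apply/(pathP x0)/forallP => [ep i | ef i].
- have := ep i; rewrite size_rcons szp -rcons_cons nth_rcons /= szp ltn_ord.
  move=> /(_ isT); rewrite nthE -(nthE (ordS i)) ordS_val nth_rcons szp eqSS.
  by have := ltn_ord i; rewrite ltnS; case: (ltngtP i n).
- rewrite size_rcons szp => lti.
  have := ef (Ordinal lti); rewrite -!nthE ordS_val /= eqSS.
  rewrite -rcons_cons !nth_rcons /= szp lti.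
  by move: lti; rewrite ltnS; case: (ltngtP i n).
Qed.

Lemma is_hom_cycleE n (G : sgraph) (f : {ffun cycle_graph n -> G}) : (1 < n)%N ->
  is_hom f = [forall i : 'I_n, adj (f i) (f (ordS i))].
Proof.
move=> n1; apply/forallP/forallP => [hf i|hf x].
  have /forallP/(_ (ordS i))/implyP := hf i; apply.
  (* It remains to see that [i] differs from its successor; in the wrap-around case this is where
     [1 < n] enters. *)
  rewrite /= /cycle_adj eqxx andbT -val_eqE [val (ordS i)]ordS_val.
  case: (i.+1 =P n) => [ni|_]; last by rewrite ltn_eqF.
  by rewrite /= -lt0n -ltnS ni.
apply/forallP => y; apply/implyP => /andP[_ /orP[]/eqP ->]; first exact: hf.
by rewrite adj_sym hf.
Qed.

Lemma hom_count_cycleE n (G : sgraph) : (1 < n)%N ->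
  hom_count (cycle_graph n) G = #|[pred t : n.-tuple G | cycle (@adj G) t]|.
Proof.
move=> n1; rewrite /hom_count -!sum1_card.
pose h (f : {ffun cycle_graph n -> G}) : n.-tuple G := [tuple f i | i < n].
rewrite [RHS](reindex h) /=; last first.
  exists (fun t => [ffun i => tnth t i]) => [f _|t _].
    by apply/ffunP => i; rewrite ffunE tnth_mktuple.
  by apply/eq_from_tnth => i; rewrite tnth_mktuple ffunE.
by apply: eq_bigl => f; rewrite !inE is_hom_cycleE // cycle_mktuple.
Qed.

Definition adjmx (R : nzRingType) (G : sgraph) : 'M[R]_#|G| :=
  \matrix_(i, j) (adj (enum_val i) (enum_val j))%:R.

(** Counts walks of length [n]; [t] lists the vertices after the start. The induction splits off the
    first step. *)
Lemma adjmx_expE (R : nzRingType) (G : sgraph) n i j :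
  (adjmx R G ^+ n) i j =
  \sum_(t : n.-tuple G) (path (@adj G) (enum_val i) t
                          && (last (enum_val i) t == enum_val j))%:R.
Proof.
elim: n i j => [|n IHn] i j.
  rewrite expr0 mxE -(inj_eq enum_val_inj) (bigD1 [tuple]) //= big1 ?addr0 //.
  by move=> t /eqP[]; rewrite tuple0.
pose h (p : G * n.-tuple G) : n.+1.-tuple G := [tuple of p.1 :: p.2].
rewrite exprS mxE [RHS](reindex h) /=; last first.
  exists (fun t => (thead t, [tuple of behead t])) => [[x t] _|t _].
    by congr pair; apply: val_inj.
  by rewrite [t in RHS]tuple_eta; apply: val_inj.
rewrite -(pair_bigA _ (fun x (t : n.-tuple G) => (adj (enum_val i) x &&
   path (@adj G) x t && (last x t == enum_val j))%:R)) /=.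
rewrite [RHS](reindex (@enum_val G predT)) /=; last exact/onW_bij/enum_val_bij.
apply: eq_bigr => k _; rewrite mxE IHn big_distrr /=; apply: eq_bigr => t _.
by rewrite -natrM mulnb andbA.
Qed.

Lemma hom_count_cycle_trace (R : nzRingType) n (G : sgraph) : (1 < n)%N ->
  (hom_count (cycle_graph n) G)%:R = \tr (adjmx R G ^+ n).
Proof.
move=> n1; rewrite hom_count_cycleE // -sum1_card natr_sum /mxtrace big_mkcond.
under [RHS]eq_bigr do rewrite adjmx_expE.
rewrite exchange_big /=; apply: eq_bigr => t _.
rewrite -(reindex (@enum_val G predT) (P := predT)
  (F := fun x => (path (@adj G) x t && (last x t == x))%:R)) /=; last first.
  exact/onW_bij/enum_val_bij.
case: n n1 t => // n _ t; case: (tupleP t) => x p /=.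
(* A closed walk starts where it ends, so only the start [last x p] contributes to the sum. *)
rewrite (bigD1 (last x p)) //= big1 => [|y]; last first.
  by rewrite eq_sym => /negPf ->; rewrite andbF.
by rewrite eqxx andbT addr0 !inE /= rcons_path andbC; case: ifP.
Qed.

(** The spectral theorem is applied over the complex numbers, where [A] becomes Hermitian. Its
    eigenvalues are real, so their real parts serve as [r] for all [k] at once. *)
Lemma mxtrace_exp_symmetric (R : realType) n (A : 'M[R]_n) : A^T = A ->
  exists r : 'rV[R]_n, forall k, \tr (A ^+ k) = \sum_i r 0 i ^+ k.
Proof.
move=> symA; pose B := map_mx (real_complex R) A.
have hB : B \is hermsymmx.
  apply: realsym_hermsym.
    by apply/is_hermitianmxP; rewrite expr0 scale1r map_mx_id // map_trmx symA.
  by apply/mxOverP => i j; rewrite mxE realE !lecE /= eqxx -realE num_real.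
have /orthomx_spectralP := hermitian_normalmx hB.
have /mxOverP := hermitian_spectral_diag_real hB.
have := spectral_unit B.
set P := spectralmx B; set d := spectral_diag B => uP dR BE.
have BX k : B ^+ k = invmx P *m diag_mx (\row_i d 0 i ^+ k) *m P.
  elim: k => [|k IHk].
    rewrite expr0 (_ : diag_mx _ = 1%:M) ?mulmx1 ?mulVmx //.
    by apply/matrixP => i j; rewrite !mxE expr0.
  rewrite exprS IHk -[_ * _]/(_ *m _) {1}BE !mulmxA mulmxK //.
  rewrite -[_ *m diag_mx d *m _]mulmxA mulmx_diag.
  by congr (_ *m diag_mx _ *m _); apply/rowP => i; rewrite !mxE exprS.
exists (\row_i complex.Re (d 0 i)) => k.
apply: (@complexI R).
rewrite -[LHS]/(real_complex R _) -trace_map_mx rmorphXn /=.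
rewrite -/B BX mxtrace_mulC mulmxA mulmxV // mul1mx mxtrace_diag.
rewrite -[RHS]/(real_complex R _) rmorph_sum; apply: eq_bigr => i _.
rewrite !mxE rmorphXn /=; congr (_ ^+ _).
by rewrite RRe_real // dR.
Qed.

(** * Homomorphisms from cycles to disjoint unions of cliques *)

Definition clique_adj n (m : 'I_n -> nat) : rel {j : 'I_n & 'I_(m j)} :=
  fun u v => (tag u == tag v) && (u != v).

Lemma clique_adj_sym n (m : 'I_n -> nat) : symmetric (@clique_adj n m).
Proof. by move=> u v; rewrite /clique_adj eq_sym [u == v]eq_sym. Qed.

Lemma clique_adj_irr n (m : 'I_n -> nat) : irreflexive (@clique_adj n m).
Proof. by move=> u; rewrite /clique_adj !eqxx. Qed.

Definition cliques n (m : 'I_n -> nat) : sgraph :=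
  SGraph (@clique_adj_sym n m) (@clique_adj_irr n m).

Lemma card_tagged_with n (m : 'I_n -> nat) j :
  #|[pred u : {j : 'I_n & 'I_(m j)} | tag u == j]| = m j.
Proof.
rewrite -[RHS]card_ord -(bij_eq_card (@untag_with_bij _ (fun j => 'I_(m j)) j)).
exact/esym/card_sig.
Qed.

(** Adjacent vertices share their tag, and every index is reached from [ord0] by successors. *)
Lemma hom_cliques_tag n (m : 'I_n -> nat) N
    (f : {ffun cycle_graph N.+2 -> cliques m}) i :
  is_hom f -> tag (f i) = tag (f ord0).
Proof.
rewrite is_hom_cycleE // => /forallP hf.
case: i => i; elim: i => [|i IHi] lti; first by congr (tag (f _)); apply: val_inj.
have lti' := ltnW lti; rewrite -(IHi lti').
have /andP[/eqP -> _] := hf (Ordinal lti').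
by congr (tag (f _)); apply: val_inj; rewrite [RHS]ordS_val /= ltn_eqF.
Qed.

Lemma hom_count_cliques n (m : 'I_n -> nat) N :
  hom_count (cycle_graph N.+2) (cliques m) =
  (\sum_j #|[pred f : {ffun cycle_graph N.+2 -> cliques m} |
              is_hom f & tag (f ord0) == j]|)%N.
Proof.
rewrite /hom_count -sum1_card.
rewrite (partition_big (fun f : {ffun _ -> cliques m} => tag (f ord0)) predT) //.
by apply: eq_bigr => j _; rewrite -sum1_card.
Qed.

Lemma hom_count_cliques_le n (m : 'I_n -> nat) N :
  (hom_count (cycle_graph N.+2) (cliques m) <= \sum_j m j ^ N.+2)%N.
Proof.
rewrite hom_count_cliques; apply: leq_sum => j _.
rewrite -[X in (_ <= _ ^ X)%N]card_ord -(card_tagged_with m j) -card_ffun_on.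
apply/subset_leq_card/fintype.subsetP => f; rewrite !inE => /andP[hf /eqP fj].
by apply/ffun_onP => i; rewrite inE /= (hom_cliques_tag i hf) fj.
Qed.

Lemma hom_count_cliques_ge n (m : 'I_n -> nat) N :
  (\sum_j m j ^_ N.+2 <= hom_count (cycle_graph N.+2) (cliques m))%N.
Proof.
rewrite hom_count_cliques; apply: leq_sum => j _.
rewrite -[X in (_ ^_ X <= _)%N]card_ord -(card_tagged_with m j).
rewrite -card_inj_ffuns_on; apply/subset_leq_card/fintype.subsetP => f.
rewrite !inE => /andP[/ffun_onP fj /injectiveP fi].
rewrite (eqP (fj _)) eqxx andbT is_hom_cycleE //; apply/forallP => i.
rewrite /= /clique_adj (eqP (fj _)) (eqP (fj _)) eqxx /= (inj_eq fi).
rewrite -val_eqE [val (ordS i)]ordS_val; case: (i.+1 =P _) => [[iN]|_]; first by rewrite /= iN.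
by rewrite ltn_eqF.
Qed.

(** * Asymptotics of the clique counts *)

(** Each of the [N] factors of the falling factorial is at least [m - N]. *)
Lemma leq_exp_ffact m N : ((m - N) ^ N <= m ^_ N)%N.
Proof.
elim: N m => [|N IHN] [|m]; rewrite ?ffact0 ?expn0 // ?sub0n ?exp0n //.
rewrite subSS ffactSS expnS leq_mul ?IHN //.
by rewrite (leq_trans (leq_subr _ _)).
Qed.

Lemma cvg_truncn_sub (R : realType) (y : R) N : 0 <= y ->
  (Num.truncn (M.+1%:R * y) - N)%:R / M.+1%:R @[M --> \oo] --> y.
Proof.
move=> y0; apply: (@squeeze_cvgr _ _ _ _
  (fun M => y - N.+1%:R * harmonic M) (fun=> y)); last exact: cvg_cst.
  apply: nearW => M; have M0 : 0 < M.+1%:R :> R by [].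
  rewrite /= ler_pdivlMr // ler_pdivrMr // mulrBl divfK ?gt_eqF //.
  have /andP[tle tgt] := truncn_itv (mulr_ge0 (ltW M0) y0).
  rewrite [y * _]mulrC; apply/andP; split.
    rewrite lerBlDr (le_trans (ltW tgt)) // -natrD ler_nat addnS ltnS.
    by rewrite addnC -leq_subLR.
  by rewrite (le_trans _ tle) // ler_nat leq_subr.
rewrite -[X in _ --> X]subr0 -[X in _ - X](mulr0 N.+1%:R).
apply: cvgB; first exact: cvg_cst.
by apply: cvgMl_tmp; exact: cvg_harmonic.
Qed.

Lemma cvg_sum_exprn (R : realType) n (u : nat -> 'I_n -> R) (y : 'I_n -> R) N :
  (forall j, u M j @[M --> \oo] --> y j) ->
  \sum_j u M j ^+ N @[M --> \oo] --> \sum_j y j ^+ N.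
Proof.
move=> uy; apply: cvg_big => [|j _]; first exact: add_continuous.
exact: (cvg_comp _ (fun z : R => z ^+ N) (uy j) (@exprn_continuous R N (y j))).
Qed.

(** Squeezed between power sums of the clique sizes, lowered by [N.+2] on the left and unchanged on
    the right; a bounded shift vanishes after division by [M.+1]. *)
Lemma cvg_hom_count_cliques (R : realType) n (y : 'I_n -> R) N :
  (forall j, 0 <= y j) ->
  (hom_count (cycle_graph N.+2)
     (cliques (fun j => Num.truncn (M.+1%:R * y j))))%:R / M.+1%:R ^+ N.+2
    @[M --> \oo] --> \sum_j y j ^+ N.+2.
Proof.
move=> y0.
have lo := @cvg_sum_exprn R n _ y N.+2 (fun j => @cvg_truncn_sub R (y j) N.+2 (y0 j)).
have hi := @cvg_sum_exprn R n _ y N.+2 (fun j => @cvg_truncn_sub R (y j) 0 (y0 j)).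
apply: squeeze_cvgr lo hi; apply: nearW => M /=.
under eq_bigr do rewrite expr_div_n.
under [X in _ <= _ <= X]eq_bigr do rewrite subn0 expr_div_n.
rewrite -!mulr_suml !ler_pM2r ?invr_gt0 ?exprn_gt0 //.
under eq_bigr do rewrite -natrX.
under [X in _ <= _ <= X]eq_bigr do rewrite -natrX.
rewrite -!natr_sum !ler_nat hom_count_cliques_le andbT.
apply: leq_trans (hom_count_cliques_ge _ _); apply: leq_sum => j _.
exact: leq_exp_ffact.
Qed.

Lemma cvg_mx (R : realType) T (F : set_system T) (FF : Filter F) m n
    (u : T -> 'M[R]_(m, n)) (v : 'M[R]_(m, n)) :
  (forall i j, u t i j @[t --> F] --> v i j) -> u t @[t --> F] --> v.
Proof.
move=> uv; apply/cvg_ballP => e e0.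
have : \forall t \near F, forall i j, ball (v i j) e (u t i j).
  apply: filter_forall => i; apply: filter_forall => j.
  by move/cvg_ballP: (uv i j); exact.
by apply: filterS => t ut; split.
Qed.

(** * The two inclusions *)

Lemma cycle_point_power_sum (R : realType) l (G : sgraph) :
  hom_count (cycle_graph 4) G <> 0%N ->
  exists n, power_sum_set R n l (cycle_point R l G).
Proof.
move=> hG.
have [r trE] : exists r : 'rV[R]_#|G|, forall k,
    \tr (adjmx R G ^+ k) = \sum_i r 0 i ^+ k.
  apply: mxtrace_exp_symmetric.
  by apply/matrixP => i j; rewrite !mxE adj_sym.
have h0 : (hom_count (cycle_graph 4) G)%:R != 0 :> R.
  by rewrite pnatr_eq0; apply/eqP.
have homE k : (1 < k)%N ->
    (hom_count (cycle_graph k) G)%:R = \sum_i r 0 i ^+ k :> R.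
  by move=> k1; rewrite (hom_count_cycle_trace R) // trE.
set h := (hom_count _ _)%:R in h0.
exists #|G|, (\row_i (r 0 i ^+ 4 / h)); split.
(* Eigenvalues may be negative, but their fourth powers are not. *)
- by move=> j; rewrite mxE divr_ge0 ?exprn_even_ge0.
- rewrite /power_sum; under eq_bigr do rewrite mxE expr1.
  by rewrite -mulr_suml -homE // divff.
- apply/rowP => k; rewrite !mxE homE //= /power_sum mulr_suml.
  by apply: eq_bigr => i _; rewrite mxE expr_div_n -exprM.
Qed.

Lemma power_sum_closure_cycle (R : realType) l n (x : 'rV[R]_n) :
  (forall j, 0 <= x 0 j) -> power_sum 1 x = 1 ->
  cycle_profile R l (\row_(k < l.-1) power_sum k.+2 x).
Proof.
(* Fourth roots turn the exponent [4 * k] of [y j] into the exponent [k] of [x 0 j]; in particular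
   the normalized [C_4] count tends to [power_sum 1 x = 1]. *)
move=> x0 x1; pose y j := Num.sqrt (Num.sqrt (x 0 j)).
have y0 j : 0 <= y j by exact: sqrtr_ge0.
have y4 j : y j ^+ 4 = x 0 j by rewrite (exprM _ 2 2) !sqr_sqrtr ?sqrtr_ge0.
pose G M := cliques (fun j => Num.truncn (M.+1%:R * y j)).
have hom4 : (hom_count (cycle_graph 4) (G M))%:R / M.+1%:R ^+ 4
    @[M --> \oo] --> (1 : R).
  have := @cvg_hom_count_cliques R n y 2 y0.
  by under eq_bigr do rewrite y4 -[x _ _]expr1; rewrite -/(power_sum 1 x) x1.
have GP : \forall M \near \oo, hom_count (cycle_graph 4) (G M) <> 0%N.
  have : \forall M \near \oo,
      (0 : R) < (hom_count (cycle_graph 4) (G M))%:R / M.+1%:R ^+ 4.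
    exact: cvgr_gt hom4 _ ltr01.
  by apply: filterS => M /[swap] ->; rewrite mul0r ltxx.
have GC : cycle_point R l (G M) @[M --> \oo]
    --> \row_(k < l.-1) power_sum k.+2 x.
  apply: cvg_mx => i k; rewrite mxE.
  (* The trivial denominator is the limit of the normalized [C_4] count raised to [k.+2]. *)
  have -> : power_sum k.+2 x = (\sum_j y j ^+ (4 * k.+2)) / 1 ^+ k.+2.
    rewrite expr1n divr1; apply: eq_bigr => j _.
    by rewrite exprM y4.
  have hom4X : ((hom_count (cycle_graph 4) (G M))%:R / M.+1%:R ^+ 4) ^+ k.+2
      @[M --> \oo] --> (1 : R) ^+ k.+2.
    exact: (cvg_comp _ (fun z : R => z ^+ k.+2) hom4 (@exprn_continuous R k.+2 1)).
  have k4 : (4 * k.+2 = (4 * k.+2 - 2).+2)%N by rewrite mulnS.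
  have := @cvg_hom_count_cliques R n y (4 * k.+2 - 2) y0; rewrite -k4 => homk.
  have one0 : (1 : R) ^+ k.+2 != 0 by rewrite expr1n oner_neq0.
  apply: cvg_trans (cvgM homk (cvgV one0 hom4X)).
  (* The powers of [M.+1] cancel in the quotient. *)
  apply: near_eq_cvg; apply: nearW => M /=.
  rewrite mxE /= -/(G M) expr_div_n -exprM invf_div mulrA divfK //.
move=> B /GC GB.
have [M [hM BM]] := filter_ex (filterI GP GB).
by exists (cycle_point R l (G M)); split => //; exists (G M).
Qed.

Theorem theorem3p1 (R : realType) (l : nat) (hl : (2 <= l)%N) :
  cycle_profile R l = power_sum_profile R l.
Proof.
apply/seteqP; split.
  apply: closureS => v [G hG ->].
  by have [n Gn] := cycle_point_power_sum R l hG; exists n.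
have cC : closed (cycle_profile R l) by exact: closed_closure.
(* A closed set is its own closure, so it is enough to reach the power-sum points themselves. *)
rewrite [X in _ `<=` X]((closure_id _).1 cC); apply: closureS.
by move=> v [n _ [x [x0 x1 ->]]]; exact: power_sum_closure_cycle.
Qed.
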